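(* Let $R_1=0.43542\ldots$ be the smallest positive root of the equation $R^4-2R^3-2R+1=0$. All complex roots of the Pell polynomials $\mathcal{P}_n(q)$ ($n\ge 1$) and $\tilde{\mathcal{P}}_n(q)$ ($n\ge 2$) belong to the annulus $$R_1<|q|<R_1^{-1}.$$
   Context: For an integer $c\ge 1$ let $[c]_q = 1+q+\cdots+q^{c-1}$. Every rational $x>0$ has a unique finite Hirzebruch-Jung continued fraction expansion $$x=\llbracket c_1,\ldots,c_N\rrbracket := c_1-\cfrac{1}{c_2-\cfrac{1}{\ddots-\cfrac{1}{c_N}}},$$ with integers $c_1\ge 1$ and $c_j\ge 2$ for $j\ge 2$. The $q$-deformation of $x$ is the rational function $$[x]_q := [c_1]_q-\cfrac{q^{c_1-1}}{[c_2]_q-\cfrac{q^{c_2-1}}{\ddots-\cfrac{q^{c_{N-1}-1}}{[c_N]_q}}}.$$ It is written uniquely as $[x]_q=\mathcal{R}(q)/\mathcal{S}(q)$ with $\mathcal{R},\mathcal{S}\in\mathbb{Z}[q]$ coprime polynomials with nonnegative integer coefficients. Let $P_n$ be the Pell numbers: $P_1=1$, $P_2=2$, $P_{n+1}=2P_n+P_{n-1}$, so that $P_{n+1}/P_n$ is the regular continued fraction $[2,2,\ldots,2]$ with $n$ entries. For $n\ge 1$, the Pell polynomials $\mathcal{P}_n(q)$ and $\tilde{\mathcal{P}}_{n+1}(q)$ are the denominator $\mathcal{S}(q)$ and numerator $\mathcal{R}(q)$ when $[x]_q$, for $x=P_{n+1}/P_n$, is written as a quotient $\mathcal{R}(q)/\mathcal{S}(q)$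 of coprime polynomials in $\mathbb{Z}[q]$ with nonnegative integer coefficients, that is, $$\left[\frac{P_{n+1}}{P_n}\right]_q=\frac{\tilde{\mathcal{P}}_{n+1}(q)}{\mathcal{P}_n(q)}.$$ *)

(* Defs.v *)
From HB Require Import structures.
From mathcomp Require Import all_boot all_order all_algebra zify ring.
From mathcomp Require Import reals.
From mathcomp Require Import complex.

Set Implicit Arguments.
Unset Strict Implicit.
Unset Printing Implicit Defensive.

Import Order.TTheory GRing.Theory Num.Theory.

Local Open Scope ring_scope.
Local Open Scope complex_scope.

Local Notation "x %:F" := (tofrac x).

Definition hj_admissible (c : seq nat) : bool :=
  if c is c1 :: s then (1 <= c1)%N && all (leq 2) s else false.

(* The values at [::] here and in [q_hj_value] are junk. *)
Fixpoint hj_value (c : seq nat) : rat :=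
  match c with
  | [::] => 0
  | [:: c1] => c1%:R
  | c1 :: s => c1%:R - (hj_value s)^-1
  end.

Definition hj_expansion (x : rat) (c : seq nat) : Prop :=
  hj_admissible c /\ hj_value c = x.

Definition qint (c : nat) : {poly int} := \sum_(i < c) 'X^i.

Fixpoint q_hj_value (c : seq nat) : {fraction {poly int}} :=
  match c with
  | [::] => 0
  | [:: c1] => (qint c1)%:F
  | c1 :: s => (qint c1)%:F - ('X^(c1.-1))%:F / q_hj_value s
  end.

Definition q_deformation (x : rat) (f : {fraction {poly int}}) : Prop :=
  exists2 c, hj_expansion x c & f = q_hj_value c.

(* Divisibility in Z[q] itself: the library's [%|] on polynomials is
   pseudo-divisibility, which ignores constant factors. *)
Definition coprime_Zq (r s : {poly int}) : Prop :=
  forall d u v : {poly int}, r = d * u -> s = d * v -> d \is a GRing.unit.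

Definition nneg_coefs (p : {poly int}) : Prop := forall i, 0 <= p`_i.

Definition reduced_quotient (f : {fraction {poly int}}) (r s : {poly int}) :
    Prop :=
  [/\ s != 0, f = r%:F / s%:F, coprime_Zq r s, nneg_coefs r & nneg_coefs s].

Fixpoint pell (n : nat) : nat :=
  match n with
  | 0 => 0
  | m.+1 => if m is k.+1 then 2 * pell m + pell k else 1
  end.

Definition pell_ratio (n : nat) : rat := (pell n.+1)%:R / (pell n)%:R.

Definition pell_quotient (n : nat) (r s : {poly int}) : Prop :=
  exists2 f, q_deformation (pell_ratio n) f & reduced_quotient f r s.

(* [is_pell_poly n p] says that p is P_n (for n >= 1), and
   [is_pell_tilde_poly n p] that p is P~_n (for n >= 2), the numerator of the
   deformation of P_n / P_(n-1). *)
Definition is_pell_poly (n : nat) (p : {poly int}) : Prop :=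
  exists r, pell_quotient n r p.

Definition is_pell_tilde_poly (n : nat) (p : {poly int}) : Prop :=
  exists s, pell_quotient n.-1 p s.

Definition smallest_positive_root (R : realType) (f : R -> R) (x : R) : Prop :=
  [/\ 0 < x, f x = 0 & forall y, 0 < y -> f y = 0 -> x <= y].

(* In R[i] the relation x < y forces x and y to have the same imaginary part,
   and the modulus `|z| is an element of R[i] with zero imaginary part. *)
Definition in_annulus (R : realType) (a b : R) (z : R[i]) : Prop :=
  a%:C < `|z| < b%:C.

Definition complex_root (R : realType) (p : {poly int}) (z : R[i]) : Prop :=
  root (map_poly intr p) z.

(* The objects quantified over above exist: every positive rational has an
   expansion, and every pell_ratio n with n >= 1 a reduced q-quotient. *)

Lemma hj_expansion_exists_ratio (p q : nat) : (0 < p)%N -> (0 < q)%N ->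
  exists2 c, hj_expansion (p%:R / q%:R) c & ((q < p)%N -> all (leq 2) c).
Proof.
elim/ltn_ind: q p => q IH p p0 q0.
pose c := ((p + q.-1) %/ q)%N; pose r := (c * q - p)%N.
have c0 : (0 < c)%N by rewrite divn_gt0 //; lia.
have hc : (p <= c * q)%N.
  have := divn_eq (p + q.-1)%N q; rewrite -/c; have := ltn_pmod (p + q.-1)%N q0; lia.
have hr : (r < q)%N.
  have := leq_divM (p + q.-1)%N q; rewrite -/c /r; lia.
have cp : (q < p)%N -> (2 <= c)%N by move=> h; case: c hc c0 {r hr} => [|[|?]]//; lia.
have q0' : (q%:R : rat) != 0 by rewrite pnatr_eq0 -lt0n.
have e : (p%:R : rat) = c%:R * q%:R - r%:R by rewrite /r natrB // natrM; ring.
have [r0|r0] := posnP r.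
  exists [:: c] => /=; last by move=> /cp ->.
  split=> /=; first by rewrite c0.
  by rewrite e r0 subr0 mulfK.
have [c' [ha hv] /(_ hr)] := IH r hr q q0 r0.
case: c' ha hv => // d s ha hv h2.
exists [:: c, d & s] => /=; last by move=> /cp ->.
split; first by rewrite /= c0.
rewrite [LHS]/= -/(hj_value (d :: s)) hv e invf_div mulrBl mulfK //.
Qed.

Lemma hj_expansion_exists (x : rat) : 0 < x -> exists c, hj_expansion x c.
Proof.
move=> x0.
have p0 : (0 < `|numq x|)%N by rewrite absz_gt0 numq_eq0 gt_eqF.
have q0 : (0 < `|denq x|)%N by rewrite absz_gt0 denq_eq0.
have [c hc _] := hj_expansion_exists_ratio p0 q0; exists c.
suff -> : x = `|numq x|%N%:R / `|denq x|%N%:R by [].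
by rewrite !natr_absz !gtr0_norm ?numq_gt0 ?denq_gt0 // divq_num_den.
Qed.

Lemma nneg_coefsD p q : nneg_coefs p -> nneg_coefs q -> nneg_coefs (p + q).
Proof. by move=> hp hq i; rewrite coefD addr_ge0. Qed.
Lemma nneg_coefsM p q : nneg_coefs p -> nneg_coefs q -> nneg_coefs (p * q).
Proof. by move=> hp hq i; rewrite coefM sumr_ge0 // => j _; rewrite mulr_ge0. Qed.
Lemma nneg_coefsXn n : nneg_coefs 'X^n.
Proof. by move=> i; rewrite coefXn ler0n. Qed.
Lemma nneg_qint n : nneg_coefs (qint n).
Proof. by move=> i; rewrite coef_sum sumr_ge0 // => j _; rewrite coefXn ler0n. Qed.

Lemma qintS n : qint n.+1 = qint n + 'X^n.
Proof. by rewrite /qint big_ord_recr. Qed.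
Lemma qintSl n : qint n.+1 = 1 + 'X * qint n.
Proof.
rewrite /qint big_ord_recl expr0 big_distrr /=; congr (_ + _).
by apply: eq_bigr => i _; rewrite exprS.
Qed.

(* The invariant carried by the tails of an expansion, whose entries are all
   at least 2. *)
Definition well_reduced (f : {fraction {poly int}}) (r s : {poly int}) :=
  [/\ nneg_coefs (r - s), nneg_coefs s, r`_0%N = 1, coprime_Zq r s
    & s != 0 /\ f = r%:F / s%:F].

Lemma well_reduced_step f r s n : well_reduced f r s ->
  let r' := qint n.+1 * r - 'X^n * s in
  reduced_quotient ((qint n.+1)%:F - ('X^n)%:F / f) r' r /\
  ((0 < n)%N -> well_reduced ((qint n.+1)%:F - ('X^n)%:F / f) r' r).
Proof.
move=> [hrs hs r0 co [sn0 ef]] r'.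
have hr : nneg_coefs r by rewrite -(subrK s r); exact: nneg_coefsD.
have rn0 : r != 0 by apply/eqP => h; move: r0; rewrite h coef0.
have e1 : r' = qint n * r + 'X^n * (r - s) by rewrite /r' qintS; ring.
have hr' : nneg_coefs r'.
  rewrite e1; apply: nneg_coefsD; apply: nneg_coefsM => //.
    exact: nneg_qint.
  exact: nneg_coefsXn.
have co' : coprime_Zq r' r.
  move=> d u v hu hv.
  have hXs : 'X^n * s = d * (qint n.+1 * v - u).
    by rewrite mulrBr -hu mulrCA -hv /r'; ring.
  have d0v : d`_0 * v`_0 = 1 by rewrite -r0 hv coefM big_ord1.
  have /(_ n) [w [k hw]] : forall n, exists w, exists k, (d * w + 'X^n * k = 1 :> {poly int}).
    have [w [k hw]] : exists w, exists k, (d * w + 'X * k = 1 :> {poly int}).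
      exists v, (- drop_poly 1 (d * v)).
      rewrite -{1}(poly_take_drop 1 (d * v)) -hv.
      have -> : take_poly 1 r = 1.
        apply/polyP => i; rewrite coef_take_poly coef1.
        by case: i => [|i] //=.
      by rewrite expr1; ring.
    elim=> [|m [w' [k' hw']]]; first by exists 0, 1; rewrite expr0; ring.
    exists (w * d * w' + w * 'X^m * k' + 'X * k * w'), (k * k').
    transitivity ((d * w + 'X * k) * (d * w' + 'X^m * k')).
      by rewrite exprS; ring.
    by rewrite hw hw' mulr1.
  apply: (co d v (s * w + (qint n.+1 * v - u) * k) hv).
  by rewrite mulrDr (mulrA d _ k) -hXs -[LHS]mulr1 -hw; ring.
have ev : (qint n.+1)%:F - ('X^n)%:F / f = r'%:F / r%:F.
  rewrite ef invf_div /r' tofracB !tofracM mulrBl mulfK ?mulrA //.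
  by rewrite tofrac_eq0.
split; first by split.
case: n @r' e1 hr' co' ev => // n r' e1 hr' co' ev _; split=> //.
  rewrite e1 qintSl.
  have -> : (1 + 'X * qint n) * r + 'X^(n.+1) * (r - s) - r =
     'X * qint n * r + 'X^(n.+1) * (r - s) by ring.
  apply: nneg_coefsD; apply: nneg_coefsM => //; last exact: nneg_coefsXn.
  by apply: nneg_coefsM; [exact: (nneg_coefsXn 1)|exact: nneg_qint].
rewrite e1 exprS -mulrA qintSl mulrDl -mulrA mul1r !coefD !coefXM eqxx.
by rewrite r0.
Qed.

Lemma well_reduced_qint n : reduced_quotient (qint n.+1)%:F (qint n.+1) 1 /\
  ((0 < n)%N -> well_reduced (qint n.+1)%:F (qint n.+1) 1).
Proof.
have h1 : nneg_coefs 1 by move=> i; rewrite coef1.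
have co : coprime_Zq (qint n.+1) 1.
  by move=> d u v _ h; apply/unitrPr; exists v.
split; first by split; rewrite ?oner_neq0 ?tofrac1 ?divr1 //; exact: nneg_qint.
move=> n0; split; rewrite ?oner_neq0 ?tofrac1 ?divr1 //.
  rewrite qintSl addrC addKr.
  by apply: nneg_coefsM; [exact: (nneg_coefsXn 1)|exact: nneg_qint].
by rewrite qintSl coefD coefXM coef1.
Qed.

Lemma well_reduced_tail c : c != [::] -> all (leq 2) c ->
  exists r s, well_reduced (q_hj_value c) r s.
Proof.
elim: c => // [[|[|n]]] // [|d t] IH _.
  by move=> _; have [_ /(_ isT) h] := well_reduced_qint n.+1; exists (qint n.+2), 1.
move=> /(IH isT) [r [s /(well_reduced_step n.+1) [_ /(_ isT) h]]].
by eexists _, _; exact: h.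
Qed.

Lemma reduced_quotient_exists c : hj_admissible c ->
  exists r s, reduced_quotient (q_hj_value c) r s.
Proof.
case: c => [//|[//|n] [|d t]] /= h.
  by have [h' _] := well_reduced_qint n; exists (qint n.+1), 1.
have [r [s /(well_reduced_step n) [h' _]]] := well_reduced_tail (isT : d :: t != [::]) h.
by eexists _, _; exact: h'.
Qed.

Lemma pell_quotient_exists n : (1 <= n)%N -> exists r s, pell_quotient n r s.
Proof.
have pg m : (0 < pell m.+1)%N.
  by elim: m => // m IH; rewrite [pell _]/= -/(pell m.+1); lia.
case: n => // n _.
have [c hc] : exists c, hj_expansion (pell_ratio n.+1) c.
  by apply: hj_expansion_exists; rewrite divr_gt0 // ltr0n pg.
have [r [s h]] := reduced_quotient_exists (proj1 hc).
by exists r, s, (q_hj_value c) => //; exists c.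
Qed.

(* Main.v *)
(* Passing from n to n + 2 acts on the pair (P~_(n+1), P_n) by a 2x2 matrix over
   Z[q] with trace T = (1 + q^2) (1 + q + q^2) and determinant q^4, because the
   expansion of P_(n+1) / P_n grows by the block 4, 2.  Hence, along each parity
   class, X_(m+2) = T X_(m+1) - q^4 X_m.  If |q| <= 11/25 or |q| >= 25/11, then
   |T| >= 5/2 |q|^2, so the inequality |X_(m+1)| >= 1/2 |q|^2 |X_m| propagates
   along the recurrence and no X_m vanishes.  Since 0.43542 <= R_1 < 0.43543 <
   11/25, this covers the complement of the annulus. *)

Require Import Defs.
From mathcomp Require Import all_boot all_order all_algebra zify ring lra.
From mathcomp Require Import reals.
From mathcomp Require Import complex.
Import Order.TTheory GRing.Theory Num.Theory.
Local Open Scope ring_scope.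

Set Implicit Arguments.
Unset Strict Implicit.

Import ComplexField.Normc.

(** * The linear recurrence behind the Pell polynomials *)

(** On fractions x = v.1 / v.2 this is x |-> [3]_q - q^2 / ([2]_q - q / (q x + 1)). *)
Definition two_step (K : comPzRingType) (q : K) (v : K * K) : K * K :=
  ((q + 2 * q ^+ 2 + q ^+ 3 + q ^+ 4) * v.1 + (1 + q) * v.2,
   (q + q ^+ 2) * v.1 + v.2).

(* The pair (P~_(k+2), P_(k+1)) at q. *)
Fixpoint q_pell {K : comPzRingType} (q : K) (k : nat) : K * K :=
  match k with
  | 0 => (1 + q, 1)
  | 1 => (1 + 2 * q + q ^+ 2 + q ^+ 3, 1 + q)
  | k'.+2 => two_step q (q_pell q k')
  end.

Definition two_step_trace (K : comPzRingType) (q : K) : K :=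
  1 + q + 2 * q ^+ 2 + q ^+ 3 + q ^+ 4.

(** Cayley-Hamilton for the matrix of [two_step], read off in each coordinate. *)
Lemma two_step_recurrence1 (K : comPzRingType) (q : K) (v : K * K) :
  (two_step q (two_step q v)).1 =
  two_step_trace q * (two_step q v).1 - q ^+ 4 * v.1.
Proof. by rewrite /two_step_trace /=; ring. Qed.

Lemma two_step_recurrence2 (K : comPzRingType) (q : K) (v : K * K) :
  (two_step q (two_step q v)).2 =
  two_step_trace q * (two_step q v).2 - q ^+ 4 * v.2.
Proof. by rewrite /two_step_trace /=; ring. Qed.

(** * Modulus estimates and the cone argument *)

Section ComplexEstimates.
Variable R : rcfType.
Implicit Types (x y z q : R[i]) (X : nat -> R[i]).

Lemma normc_ge0 x : 0 <= normc x.
Proof. by case: x => a b; exact: sqrtr_ge0. Qed.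

Lemma normc_gt0 x : (0 < normc x) = (x != 0).
Proof.
rewrite lt0r normc_ge0 andbT; congr (~~ _).
by apply/eqP/eqP => [/eq0_normc|->]; rewrite ?normc0.
Qed.

Lemma normcX x k : normc (x ^+ k) = normc x ^+ k.
Proof.
elim: k => [|k IH]; first by rewrite !expr0 normc1.
by rewrite !exprS normcM IH.
Qed.

Lemma ler_normcD x y : normc (x + y) <= normc x + normc y.
Proof. exact: le_normcD. Qed.

Lemma lerB_normcD x y : normc x - normc y <= normc (x + y).
Proof.
have := ler_normcD (x + y) (- y); rewrite addrK.
have -> : normc (- y) = normc y by exact: normcN.
by lra.
Qed.

Lemma lerB_normcB x y : normc x - normc y <= normc (x - y).
Proof.
have := lerB_normcD x (- y).
by have -> : normc (- y) = normc y by exact: normcN.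
Qed.

(** The factor 1/2 reproduces itself, being a fixed point of c |-> 5/2 - 1/c. At q = 0 the cone
    inequality says nothing, and nonvanishing comes from t != 0. *)
Lemma cone_neq0 X t q : (forall m, X m.+2 = t * X m.+1 - q ^+ 4 * X m) ->
  t != 0 -> 5 / 2 * normc q ^+ 2 <= normc t -> X 0 != 0 -> X 1 != 0 ->
  1 / 2 * normc q ^+ 2 * normc (X 0) <= normc (X 1) ->
  forall m, X m != 0.
Proof.
move=> rec t0 ht X0 X1 h01.
suff H m : X m.+1 != 0 /\ 1 / 2 * normc q ^+ 2 * normc (X m) <= normc (X m.+1).
  by case=> // m; have [] := H m.
elim: m => // m [h0 h]; have := lerB_normcB (t * X m.+1) (q ^+ 4 * X m).
rewrite -rec [normc (q ^+ 4 * _)]normcM normcX normcM.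
move: t0 h0; rewrite -!normc_gt0.
move: (normc q) (normc t) (normc (X m)) (normc (X m.+1)) (normc (X m.+2))
  h ht (normc_ge0 q) => r T a b c h ht r0 T0 b0 hc.
have s0 : 0 <= r ^+ 2 by exact: exprn_ge0.
have h1 : r ^+ 4 * a <= 2 * r ^+ 2 * b.
  by have := ler_wpM2l s0 h; rewrite (_ : r ^+ 4 = r ^+ 2 * r ^+ 2); [lra|ring].
have h2 : 5 / 2 * r ^+ 2 * b <= T * b by rewrite ler_pM2r.
have h3 : 0 < T * b by exact: mulr_gt0.
by split; lra.
Qed.

(* T = (1 + q^2) (1 + q + q^2), and both factors have an explicit lower bound on
   the circle of radius r: they give |T|^2 >= 3/4 (1 - r^2)^4. *)
Lemma two_step_trace_ge q : 3 / 4 * (1 - normc q ^+ 2) ^+ 4 <=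
  normc (two_step_trace q) ^+ 2.
Proof.
have -> : two_step_trace q = (1 + q ^+ 2) * (1 + q + q ^+ 2).
  by rewrite /two_step_trace; ring.
rewrite normcM exprMn.
have E z : normc z ^+ 2 = complex.Re z ^+ 2 + complex.Im z ^+ 2.
  by case: z => a b; rewrite sqr_sqrtr ?addr_ge0 ?sqr_ge0.
rewrite !E; case: q => u v /=.
(* For fixed r^2 = u^2 + v^2, both squared moduli are quadratics in u; here the squares are
   completed. *)
rewrite (_ : (_ ^+ 2 + _) * _ = ((1 - (u ^+ 2 + v ^+ 2)) ^+ 2 + (2 * u) ^+ 2) *
  ((2 * u + (1 + (u ^+ 2 + v ^+ 2)) / 2) ^+ 2 +
   3 / 4 * (1 - (u ^+ 2 + v ^+ 2)) ^+ 2)); last first.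
  by field.
set p := 1 - _; set w := 2 * u + _.
have := sqr_ge0 p; have := sqr_ge0 w; have := sqr_ge0 (2 * u).
move: (w ^+ 2) ((2 * u) ^+ 2) => a b ha hb hp.
rewrite (_ : p ^+ 4 = p ^+ 2 * p ^+ 2); last by ring.
move: (p ^+ 2) hp => d hp.
have := mulr_ge0 ha hb; have := mulr_ge0 hp hb; have := mulr_ge0 hp ha; lra.
Qed.

(** * Nonvanishing away from the unit circle *)

(** 11/25 lies between R_1 and 0.456..., the smaller positive solution of 3 r^2 = (1 - r^2)^2. *)
Definition far_from_unit_circle (r : R) := (r <= 11 / 25) \/ (25 / 11 <= r).

Section FarFromUnitCircle.
Variable q : R[i].
Hypothesis hq : far_from_unit_circle (normc q).

Lemma two_step_trace_far :
  two_step_trace q != 0 /\ 5 / 2 * normc q ^+ 2 <= normc (two_step_trace q).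
Proof.
have h := two_step_trace_ge q.
have r0 := normc_ge0 q; have T0 := normc_ge0 (two_step_trace q).
rewrite -normc_gt0 lt_def T0 andbT.
move: (normc q) (normc (two_step_trace q)) hq r0 T0 h => r T hr r0 T0 h.
(* This yields |T|^2 >= 3/4 * 9 r^4 = 27/4 r^4, above the required 25/4 r^4. *)
have hs : 3 * r ^+ 2 <= (1 - r ^+ 2) ^+ 2 /\ 0 < (1 - r ^+ 2) ^+ 2.
  have [r2 r21] : 0 <= (r ^+ 2 - 11 / 25 * (11 / 25)) *
    (r ^+ 2 - 25 / 11 * (25 / 11)) /\ r ^+ 2 != 1.
    case: hr => hr.
      have h2 : r ^+ 2 <= 11 / 25 * (11 / 25) by rewrite expr2; exact: ler_pM.
      by split; [apply: mulr_le0; lra|rewrite lt_eqF //; lra].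
    have h2 : 25 / 11 * (25 / 11) <= r ^+ 2.
      by rewrite expr2; apply: ler_pM => //; lra.
    by split; [apply: mulr_ge0; lra|rewrite gt_eqF //; lra].
  rewrite exprn_even_gt0 //= subr_eq0 eq_sym; split=> //.
  by have := sqr_ge0 r; move: (r ^+ 2) r2 => s r2 s0; nra.
move: h hs (sqr_ge0 r).
rewrite (_ : (1 - r ^+ 2) ^+ 4 = (1 - r ^+ 2) ^+ 2 * (1 - r ^+ 2) ^+ 2);
  last by ring.
move: (r ^+ 2) => s; move: ((1 - s) ^+ 2) => d h [h1 h2] s0.
split; first by apply/eqP => T00; rewrite T00 in h; nra.
rewrite -(ler_pXn2r (isT : (0 < 2)%N)) ?nnegrE //; last by nra.
nra.
Qed.

Let T_neq0 := proj1 two_step_trace_far.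
Let T_ge := proj2 two_step_trace_far.
Let r_ge0 := normc_ge0 q.

Lemma add1_neq0 : 1 + q != 0.
Proof.
apply/eqP => h; have e : q = -1 by rewrite -[q](addKr 1) h addr0.
have : normc q = 1.
  by rewrite e -(normc1 R); exact: normcN.
by case: hq => [|] + e1; rewrite e1; lra.
Qed.

(** Starts the even-indexed sequences: P_4 = T P_2 and P~_4 = T P~_2, as if P_0 = P~_0 = 0. *)
Lemma mul_trace_cone a : a != 0 -> two_step_trace q * a != 0 /\
  1 / 2 * normc q ^+ 2 * normc a <= normc (two_step_trace q * a).
Proof.
move=> a0; rewrite mulf_neq0 // normcM; split=> //.
rewrite ler_pM2r ?normc_gt0 //; apply: le_trans T_ge.
have := exprn_ge0 2 r_ge0; lra.
Qed.

(** The cone inequality for the pair P~_1 = 1/q, P~_3, written so that it makes sense at q = 0. *)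
Lemma tilde_pell3_ge : let a := 1 + 2 * q + q ^+ 2 + q ^+ 3 in
  a != 0 /\ 1 / 2 * normc q <= normc a.
Proof.
move=> a.
have r0 := r_ge0; rewrite -normc_gt0.
case: (hq) => hr.
  have e : a = (1 + q) ^+ 2 + q ^+ 3 by rewrite /a; ring.
  have h1 := lerB_normcD ((1 + q) ^+ 2) (q ^+ 3); rewrite -e !normcX in h1.
  have h2 := lerB_normcD 1 q; rewrite normc1 in h2.
  move: (normc (1 + q)) (normc a) h1 h2 => b c h1 h2.
  have h3 : (14 / 25) ^+ 2 <= b ^+ 2 by rewrite lerXn2r // ?nnegrE; lra.
  have h4 : normc q ^+ 3 <= (11 / 25) ^+ 3 by rewrite lerXn2r // ?nnegrE; lra.
  by split; lra.
have e : two_step_trace q - 1 = q * a by rewrite /a /two_step_trace; ring.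
have h1 := lerB_normcB (two_step_trace q) 1; rewrite e normcM normc1 in h1.
have := T_ge; move: (normc a) h1 => c h1 h2.
have h3 : 1 / 2 * normc q ^+ 2 <= normc q * c.
  have : 1 <= normc q ^+ 2 by rewrite exprn_ege1; lra.
  by lra.
have r1 : 0 < normc q by lra.
have h4 : 1 / 2 * normc q <= c by move: h3; rewrite expr2 mulrCA ler_pM2l.
by split; lra.
Qed.

(** Starts the sequence P_1 = 1, P_3, P_5, ... *)
Lemma pell3_ge : let a := 1 + q + 2 * q ^+ 2 + q ^+ 3 in
  a != 0 /\ 1 / 2 * normc q ^+ 2 <= normc a.
Proof.
move=> a.
have r0 := r_ge0; rewrite -normc_gt0.
have e : a = 1 + q * (1 + q) ^+ 2 by rewrite /a; ring.
have h1 := lerB_normcD 1 (q * (1 + q) ^+ 2).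
have h1' := lerB_normcD (q * (1 + q) ^+ 2) 1.
rewrite [_ + 1]addrC -e normcM normcX normc1 in h1 h1'.
case: (hq) => hr.
  have h2 := ler_normcD 1 q; rewrite normc1 in h2.
  have h3 : normc (1 + q) ^+ 2 <= (36 / 25) ^+ 2.
    by rewrite lerXn2r // ?nnegrE ?normc_ge0; lra.
  have h4 := ler_pM (normc_ge0 q) (sqr_ge0 (normc (1 + q))) hr h3.
  split; first by lra.
  (* The recurrence run backwards, with P_(-1) = 1. *)
  have e' : two_step_trace q - q ^+ 4 = a by rewrite /a /two_step_trace; ring.
  have := lerB_normcB (two_step_trace q) (q ^+ 4); rewrite e' normcX => h5.
  have := T_ge.
  have : normc q ^+ 2 <= (11 / 25) ^+ 2 by rewrite lerXn2r // ?nnegrE; lra.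
  have := sqr_ge0 (normc q); move: h5.
  rewrite (_ : normc q ^+ 4 = normc q ^+ 2 * normc q ^+ 2); last by ring.
  by move: (normc q ^+ 2) => s; nra.
have h2 := lerB_normcD q 1; rewrite normc1 [q + 1]addrC in h2.
have h3 : (normc q - 1) ^+ 2 <= normc (1 + q) ^+ 2.
  by rewrite lerXn2r // ?nnegrE ?normc_ge0; lra.
have := ler_wpM2l r0 h3; move: (normc a) h1' => c h4 h5.
(* With r = |q|, the cubic r (r - 1)^2 - 1 - r^2 / 2 is the product in [h6] plus a positive
   combination of (r - 25/11)^2, r - 25/11 and 1. *)
have h6 : 0 <= (normc q - 25 / 11) * (normc q - 2) ^+ 2.
  by apply: mulr_ge0; [lra|exact: sqr_ge0].
have h7 : 0 <= (normc q - 25 / 11) ^+ 2 by exact: sqr_ge0.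
have h8 := sqr_ge0 (normc q).
by split; nra.
Qed.

(* The q^3 is q^4 X_0, where the recurrence extends to X_0 = P~_1 = 1/q. *)
Lemma tilde_pell5_cone : let a := 1 + 2 * q + q ^+ 2 + q ^+ 3 in
  two_step_trace q * a - q ^+ 3 != 0 /\
  1 / 2 * normc q ^+ 2 * normc a <= normc (two_step_trace q * a - q ^+ 3).
Proof.
move=> a; have [a0 ha] : a != 0 /\ _ := tilde_pell3_ge.
have := lerB_normcB (two_step_trace q * a) (q ^+ 3).
rewrite -normc_gt0 normcM normcX => h.
have a_gt0 : 0 < normc a by rewrite normc_gt0.
have T_gt0 : 0 < normc (two_step_trace q) by rewrite normc_gt0.
have h1 : 5 / 2 * normc q ^+ 2 * normc a <= normc (two_step_trace q) * normc a.
  by rewrite ler_pM2r.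
have h2 : normc q ^+ 3 <= 2 * normc q ^+ 2 * normc a.
  by have := ler_wpM2l (sqr_ge0 (normc q)) ha; rewrite exprSr; lra.
have h3 := mulr_gt0 T_gt0 a_gt0.
by split; lra.
Qed.

Lemma q_pell_neq0 k : (q_pell q k).1 != 0 /\ (q_pell q k).2 != 0.
Proof.
have q1 := add1_neq0.
(* Four sequences, in this order: P~_3, P~_5, ...; P_2, P_4, ...; P~_2, P~_4, ...; P_1, P_3, ... *)
rewrite -(odd_double_half k) addnC; move: k./2 => m.
case: (odd k); rewrite ?addn1 ?addn0; split; move: m.
- apply: (@cone_neq0 (fun m => (q_pell q m.*2.+1).1) _ q _ T_neq0 T_ge) => //=.
  + by move=> m; exact: two_step_recurrence1.
  + by case: tilde_pell3_ge.
  + have [+ _] := tilde_pell5_cone.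
    by congr (_ != 0); rewrite /two_step_trace; ring.
  + have [_] := tilde_pell5_cone.
    by congr (_ <= normc _); rewrite /two_step_trace; ring.
- apply: (@cone_neq0 (fun m => (q_pell q m.*2.+1).2) _ q _ T_neq0 T_ge) => //=.
  + by move=> m; exact: two_step_recurrence2.
  + have [+ _] := mul_trace_cone q1.
    by congr (_ != 0); rewrite /two_step_trace; ring.
  + have [_] := mul_trace_cone q1.
    by congr (_ <= normc _); rewrite /two_step_trace; ring.
- apply: (@cone_neq0 (fun m => (q_pell q m.*2).1) _ q _ T_neq0 T_ge) => //=.
  + by move=> m; exact: two_step_recurrence1.
  + have [+ _] := mul_trace_cone q1.
    by congr (_ != 0); rewrite /two_step_trace; ring.
  + have [_] := mul_trace_cone q1.
    by congr (_ <= normc _); rewrite /two_step_trace; ring.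
- apply: (@cone_neq0 (fun m => (q_pell q m.*2).2) _ q _ T_neq0 T_ge) => //=.
  + by move=> m; exact: two_step_recurrence2.
  + exact: oner_neq0.
  + have [+ _] := pell3_ge.
    by congr (_ != 0); ring.
  + have [_] := pell3_ge.
    (* The square root is [normc 1], unfolded by simplification. *)
    rewrite (_ : Num.sqrt _ = 1) ?mulr1; last exact: (normc1 R).
    by congr (_ <= normc _); ring.
Qed.

End FarFromUnitCircle.
End ComplexEstimates.

(** * Common roots of coprime integer polynomials *)

(* Gauss's lemma turns the weak coprimality of Z[q] into a nonzero resultant. *)
Lemma coprime_Zq_no_common_root (K : numFieldType) (r s : {poly int}) (z : K) :
  coprime_Zq r s -> s != 0 -> root (map_poly intr r) z ->
  ~~ root (map_poly intr s) z.
Proof.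
move=> co s0 rz; apply/negP => sz.
have size1 : size (gcdp r s) = 1.
  (* The primitive part of the gcd divides r and s in Z[q] itself, so it is a unit; it has the size
     of the gcd. *)
  have [u hu] := dvdpP_int (dvdp_gcdl r s).
  have [v hv] := dvdpP_int (dvdp_gcdr r s).
  by have := co _ _ _ hu hv; rewrite poly_unitE size_zprimitive => /andP[/eqP].
have const p :
  root (map_poly (intr : int -> K) p) z -> p != 0 -> (1 < size p)%N.
  move=> pz p0; rewrite ltnNge; apply/negP => /size1_polyC e; move: pz p0.
  by rewrite e map_polyC rootC intr_eq0 polyC_eq0 => ->.
have r0 : r != 0.
  by apply/eqP => e; have := const s sz s0; rewrite -(gcd0p s) -e size1.
have [uv _ e] := resultant_in_ideal (const r rz r0) (const s sz s0).
have : resultant r s != 0 by rewrite resultant_eq0 size1.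
rewrite -(intr_eq0 K) => /negP; apply.
have := congr1 (fun p => (map_poly (intr : int -> K) p).[z]) e.
rewrite /= map_polyC hornerC rmorphD !rmorphM /= !hornerE => ->.
by rewrite (rootP rz) (rootP sz) !mulr0 addr0.
Qed.

(** Roots pass from a reduced fraction r / s to any equal fraction a / b: where s vanishes r does
    not, so b must, and symmetrically. *)
Lemma cross_mul_roots (K : numFieldType) (r s a b : {poly int}) (z : K) :
  coprime_Zq r s -> s != 0 -> r * b = a * s ->
  (root (map_poly intr s) z -> root (map_poly intr b) z) /\
  (root (map_poly intr r) z -> root (map_poly intr a) z).
Proof.
move=> co s0 e; have no := coprime_Zq_no_common_root (z := z) co s0.
have E : root (map_poly intr r) z || root (map_poly intr b) z =
  root (map_poly intr a) z || root (map_poly intr s) z.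
  by rewrite -!rootM -!rmorphM /= e.
split=> h; rewrite h ?orbT in E.
  by case/orP: E => // /no; rewrite h.
by have := no h; case/esym/orP: E => // ->.
Qed.

(** * Uniqueness of Hirzebruch-Jung expansions *)

Lemma hj_value_cons c s : s != [::] ->
  hj_value (c :: s) = c%:R - (hj_value s)^-1.
Proof. by case: s. Qed.

Lemma q_hj_value_cons c s : s != [::] ->
  q_hj_value (c :: s) = tofrac (qint c) - tofrac 'X^(c.-1) / q_hj_value s.
Proof. by case: s. Qed.

Lemma hj_value_gt1 s : s != [::] -> all (leq 2) s -> 1 < hj_value s.
Proof.
elim: s => // c [|d s] IH _ /andP[c2 hs].
  by rewrite /= ltr1n.
have h := IH isT hs; rewrite hj_value_cons //.
have : (hj_value (d :: s))^-1 < 1 by rewrite invf_lt1 // (lt_trans ltr01).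
have : (2%:R : rat) <= c%:R by rewrite ler_nat.
lra.
Qed.

(** The first entry is the ceiling of the value, so the value determines it. *)
Lemma hj_value_head c s : all (leq 2) s ->
  hj_value (c :: s) <= c%:R /\ c%:R < hj_value (c :: s) + 1.
Proof.
case: s => [|d s] hs; first by rewrite /=; lra.
have h := hj_value_gt1 (isT : d :: s != [::]) hs; rewrite hj_value_cons //.
have : (hj_value (d :: s))^-1 < 1 by rewrite invf_lt1 // (lt_trans ltr01).
have : 0 < (hj_value (d :: s))^-1 by rewrite invr_gt0 (lt_trans ltr01).
lra.
Qed.

Lemma hj_value_inj c d s t : all (leq 2) s -> all (leq 2) t ->
  hj_value (c :: s) = hj_value (d :: t) -> c :: s = d :: t.
Proof.
elim: s c d t => [|c' s IH] c d t hs ht e.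
all: have [a1 a2] := hj_value_head c hs; have [b1 b2] := hj_value_head d ht.
all: have h1 : c%:R < d%:R + 1 :> rat by move: a1 a2 b1 b2 e; lra.
all: have h2 : d%:R < c%:R + 1 :> rat by move: a1 a2 b1 b2 e; lra.
all: rewrite !natr1 !ltr_nat !ltnS in h1 h2.
all: have cd : c = d by apply/eqP; rewrite eqn_leq h1.
all: subst d; congr cons; case: t ht e {a1 a2 b1 b2 h1 h2} => [|d' t] // ht.
(* Two expansions cannot differ by one stopping early: a nonempty tail puts the value strictly below
   its head. *)
- move=> /eqP; rewrite [X in _ == X]hj_value_cons // eq_sym lt_eqF //.
  by rewrite gtrBl invr_gt0 (lt_trans ltr01) ?hj_value_gt1.
- move=> /eqP; rewrite [X in X == _]hj_value_cons // lt_eqF //.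
  by rewrite gtrBl invr_gt0 (lt_trans ltr01) ?hj_value_gt1.
- rewrite [LHS]hj_value_cons // [RHS]hj_value_cons //.
  move=> /addrI/oppr_inj/invr_inj.
  by apply: IH; [case/andP: hs|case/andP: ht].
Qed.

Lemma hj_expansion_inj x c d : hj_expansion x c -> hj_expansion x d -> c = d.
Proof.
case: c d => [|c s] [|d t] [//= /andP[_ hs] e] [//= /andP[_ ht] e'].
by apply: hj_value_inj => //; rewrite [LHS]e -e'.
Qed.

(** * Expansions and q-deformations of the Pell ratios *)

(* The Hirzebruch-Jung expansion of 1 + P_(k+2) / P_(k+1). *)
Fixpoint pell_hj (k : nat) : seq nat :=
  match k with
  | 0 => [:: 3]
  | 1 => [:: 4; 2]
  | k'.+2 => [:: 4, 2 & pell_hj k']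
  end%N.

(** Undoes the shift by 1 in [pell_hj], which is there to make its recursion a plain prefixing of 4,
    2. *)
Definition decr_head (s : seq nat) : seq nat :=
  if s is c :: t then c.-1 :: t else [::].

Lemma nat_ind2 (P : nat -> Prop) : P 0 -> P 1 -> (forall k, P k -> P k.+2) ->
  forall k, P k.
Proof.
move=> P0 P1 PS k; suff [] : P k /\ P k.+1 by [].
by elim: k => // k [h1 h2]; split=> //; exact: PS.
Qed.

Lemma pell_gt0 k : (0 < pell k.+1)%N.
Proof. by elim: k => // k IH; rewrite [pell _]/= -/(pell k.+1); lia. Qed.

Lemma pellSS k : pell k.+2 = (2 * pell k.+1 + pell k)%N.
Proof. by []. Qed.

Lemma pell_hj_shape k : exists c s,
  pell_hj k = c.+1 :: s /\ (2 <= c)%N && all (leq 2) s.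
Proof.
elim/nat_ind2: k => [||k [c [s [e h]]]]; try by eexists _, _.
exists 3%N, (2%N :: pell_hj k); split=> //.
by case/andP: h => c2 hs; rewrite e /= hs !andbT; lia.
Qed.

Lemma pell_hj_value k : hj_value (pell_hj k) = 1 + pell_ratio k.+1.
Proof.
elim/nat_ind2: k => // k IH.
have [c [s [e _]]] := pell_hj_shape k.
have nz : pell_hj k != [::] by rewrite e.
rewrite [pell_hj _]/= !hj_value_cons // IH /pell_ratio.
have : ((pell k.+1)%:R : rat) != 0 by rewrite pnatr_eq0 -lt0n pell_gt0.
have : ((pell k.+2)%:R : rat) != 0 by rewrite pnatr_eq0 -lt0n pell_gt0.
have : ((pell k.+3)%:R : rat) != 0 by rewrite pnatr_eq0 -lt0n pell_gt0.
have : ((pell k.+1)%:R + (pell k.+2)%:R : rat) != 0.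
  by rewrite -natrD pnatr_eq0 -lt0n addn_gt0 pell_gt0.
have PSS j : (pell j.+2)%:R = 2 * (pell j.+1)%:R + (pell j)%:R :> rat.
  by rewrite pellSS natrD natrM.
rewrite (PSS k.+2) (PSS k.+1).
move: (pell k.+1)%:R (pell k.+2)%:R => a b hab h2ba hb ha.
by field; repeat (apply/andP; split=> //).
Qed.

Lemma pell_expansion k : hj_expansion (pell_ratio k.+1) (decr_head (pell_hj k)).
Proof.
have := pell_hj_value k; have [c [s [e /andP[h1 h2]]]] := pell_hj_shape k.
rewrite e [decr_head _]/= => h; split; first by rewrite /= h2 andbT; lia.
apply: (addrI (1 : rat)); rewrite -h; case: s {e h h2} => [|d s].
  exact: nat1r.
by rewrite (hj_value_cons c.+1) // (hj_value_cons c) // -nat1r addrA.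
Qed.

(** Certifies that the denominators met in the fraction field are nonzero. *)
Lemma q_pell_coef0 k :
  (q_pell ('X : {poly int}) k).1`_0 = 1 /\
  (q_pell ('X : {poly int}) k).2`_0 = 1.
Proof.
rewrite -!horner_coef0; elim/nat_ind2: k => [||k [h1 h2]].
all: by rewrite /= !hornerE ?h1 ?h2.
Qed.

Lemma coef0_neq0 (p : {poly int}) : p`_0 = 1 -> p != 0.
Proof. by move=> h; apply/eqP => e; rewrite e coef0 in h. Qed.

Lemma qintE : (qint 2 = 1 + 'X) /\ (qint 3 = 1 + 'X + 'X ^+ 2) /\
  (qint 4 = 1 + 'X + 'X ^+ 2 + 'X ^+ 3).
Proof. by rewrite /qint !big_ord_recr big_ord0 /= add0r expr0 expr1. Qed.

Lemma tofrac_sub_div (D : idomainType) (a b w r : D) : r != 0 ->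
  tofrac a - tofrac b * (tofrac w / tofrac r) =
  tofrac (a * r - b * w) / tofrac r.
Proof.
move=> r0; have n0 : tofrac r != 0 by rewrite tofrac_eq0.
by apply: (mulIf n0); rewrite mulrBl mulrA !divfK // -!tofracM -tofracB.
Qed.

Lemma q_pell_hj_value k : let v := q_pell ('X : {poly int}) k in
  q_hj_value (pell_hj k) = tofrac ('X * v.1 + v.2) / tofrac v.2.
Proof.
have [q2 [q3 q4]] := qintE.
elim/nat_ind2: k => [||k IH].
- by rewrite /= tofrac1 divr1 q3; congr tofrac; ring.
- rewrite /= q4 q2.
  have n0 : tofrac (1 + 'X : {poly int}) != 0.
    by rewrite tofrac_eq0 coef0_neq0 // -horner_coef0 !hornerE.
  apply: (mulIf n0); rewrite mulrBl !divfK // -tofracM -tofracB.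
  by congr tofrac; ring.
- have [c [s [e _]]] := pell_hj_shape k.
  have nz : pell_hj k != [::] by rewrite e.
  rewrite [pell_hj _]/= !q_hj_value_cons // IH.
  have [] := q_pell_coef0 k.+2; have [] := q_pell_coef0 k.
  rewrite [q_pell _ k.+2]/=; case: (q_pell 'X k) => u w; rewrite /two_step /=.
  rewrite q4 q2 /=.
  move=> u0 w0 u'0 w'0.
  have n1 : 'X * u + w != 0 by rewrite coef0_neq0 // coefD coefXM w0 add0r.
  have n2 := coef0_neq0 w0; have n3 := coef0_neq0 w'0.
  rewrite invf_div tofrac_sub_div //.
  (* The numerator of the inner fraction, from the entry 2, is the second coordinate of
     [two_step]. *)
  rewrite (_ : (1 + 'X) * _ - _ = ('X + 'X ^+ 2) * u + w);
    last by rewrite expr1; ring.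
  by rewrite invf_div tofrac_sub_div //; congr (tofrac _ / _); ring.
Qed.

(** The translation rule [x + 1]_q = q [x]_q + 1, which accounts for the numerator q v.1 + v.2 in
    [q_pell_hj_value]. *)
Lemma q_hj_valueS c s :
  q_hj_value (c.+2 :: s) = tofrac 'X * q_hj_value (c.+1 :: s) + 1.
Proof.
case: s => [|d s]; first by rewrite /= qintSl tofracD tofracM tofrac1 addrC.
rewrite (q_hj_value_cons c.+2) // (q_hj_value_cons c.+1) //.
by rewrite qintSl exprS tofracD !tofracM tofrac1 /=; ring.
Qed.

Lemma q_pell_expansion k : let v := q_pell ('X : {poly int}) k in
  q_hj_value (decr_head (pell_hj k)) = tofrac v.1 / tofrac v.2.
Proof.
have := q_pell_hj_value k; have [_] := q_pell_coef0 k.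
have [[|c] [s [e // _]]] := pell_hj_shape k.
move: (q_pell _ k) => v v0; rewrite e [decr_head _]/= q_hj_valueS; lazy zeta.
move: (q_hj_value _) => f.
have n0 : tofrac v.2 != 0 by rewrite tofrac_eq0 coef0_neq0.
have X0 : tofrac ('X : {poly int}) != 0 by rewrite tofrac_eq0 polyX_eq0.
rewrite tofracD tofracM; move: (tofrac 'X) (tofrac v.1) (tofrac v.2) X0 n0.
by move=> x a b X0 n0; rewrite mulrDl divff // -mulrA => /addIr /(mulfI X0).
Qed.

Lemma tofrac_div_eq (D : idomainType) (a b c d : D) : b != 0 -> d != 0 ->
  tofrac a / tofrac b = tofrac c / tofrac d -> a * d = c * b.
Proof.
move=> b0 d0 /eqP; rewrite eqr_div ?tofrac_eq0 // -!tofracM tofrac_eq.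
by move/eqP.
Qed.

Lemma pell_quotient_cross k r s (v := q_pell ('X : {poly int}) k) :
  pell_quotient k.+1 r s -> [/\ coprime_Zq r s, s != 0 & r * v.2 = v.1 * s].
Proof.
move=> [f [c hc ->] [s0 + co _ _]].
rewrite (hj_expansion_inj hc (pell_expansion k)) q_pell_expansion => e.
have [_ /coef0_neq0 v0] := q_pell_coef0 k.
by split=> //; apply: tofrac_div_eq (esym e).
Qed.

(** Taken at the evaluation morphism, it links the formal pair over Z[q] to the complex numbers
    shown nonzero in [q_pell_neq0]. *)
Lemma rmorph_q_pell (K L : comPzRingType) (f : {rmorphism K -> L}) (q : K) k :
  (f (q_pell q k).1, f (q_pell q k).2) = q_pell (f q) k.
Proof.
elim/nat_ind2: k => [||k IH] /=; last rewrite -IH; rewrite /two_step /=.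
all: by congr (_, _); rewrite !(rmorphD, rmorphM, rmorph1) /=; ring.
Qed.

Lemma pell_quotient_root_close (R : realType) k r s (z : R[i]) :
  pell_quotient k.+1 r s -> complex_root r z \/ complex_root s z ->
  ~ far_from_unit_circle (normc z).
Proof.
move=> /pell_quotient_cross [co s0 e] h /q_pell_neq0 /(_ k).
have e' := rmorph_q_pell (horner_eval z \o map_poly intr) ('X : {poly int}) k.
rewrite /= map_polyX /horner_eval hornerX in e'; rewrite -{}e' /=.
have [h1 h2] := cross_mul_roots z co s0 e.
by case: h => [/h2 /rootP|/h1 /rootP] ->; rewrite eqxx; case.
Qed.

Lemma in_annulusE (R : realType) (a b : R) (z : R[i]) :
  a < normc z < b -> in_annulus a b z.
Proof.
by rewrite /in_annulus -!ltcR; case: z.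
Qed.

(** * The radius R_1 and the theorem *)

(** The smaller root of x^2 - (1 + sqrt 3) x + 1, whose discriminant is 2 sqrt 3. *)
Definition pell_radius (R : realType) : R :=
  (1 + Num.sqrt 3 - Num.sqrt (2 * Num.sqrt 3)) / 2.

Section PellRadius.
Variable R : realType.
Let w : R := Num.sqrt 3.
Let v : R := Num.sqrt (2 * w).

(** Seven decimals are kept because R_1 exceeds 0.43542 by only about 5 * 10^-7. *)
Lemma sqrt3_bounds : w ^+ 2 = 3 /\
  1732 / 1000 + 508 / 10 ^+ 7 < w < 1732 / 1000 + 509 / 10 ^+ 7.
Proof.
have w2 : w ^+ 2 = 3 by rewrite sqr_sqrtr.
split=> //; apply/andP; split.
all: by rewrite -(ltr_pXn2r (isT : (0 < 2)%N)) ?nnegrE ?sqrtr_ge0 ?w2 //; lra.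
Qed.

Lemma sqrt_sqrt12_bounds : v ^+ 2 = 2 * w /\
  1861 / 1000 + 2097 / 10 ^+ 7 < v < 1861 / 1000 + 2098 / 10 ^+ 7.
Proof.
have [w2 /andP[w1 w3]] := sqrt3_bounds.
have v2 : v ^+ 2 = 2 * w by rewrite sqr_sqrtr //; lra.
split=> //; apply/andP; split.
all: by rewrite -(ltr_pXn2r (isT : (0 < 2)%N)) ?nnegrE ?sqrtr_ge0 ?v2 //; lra.
Qed.

Lemma pell_radius_bounds :
  4 / 10 + 3 / 10 ^+ 2 + 5 / 10 ^+ 3 + 4 / 10 ^+ 4 + 2 / 10 ^+ 5 <= pell_radius R
    < 4 / 10 + 3 / 10 ^+ 2 + 5 / 10 ^+ 3 + 4 / 10 ^+ 4 + 3 / 10 ^+ 5.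
Proof.
have [_ /andP[w1 w2]] := sqrt3_bounds.
have [_ /andP[v1 v2]] := sqrt_sqrt12_bounds.
rewrite /pell_radius -/w -/v; apply/andP; split; lra.
Qed.

(* x^4 - 2x^3 - 2x + 1 = (x^2 - (1+w)x + 1) (x^2 - (1-w)x + 1), and the second
   factor has no real root. *)
Lemma pell_radius_smallest : smallest_positive_root
  (fun x : R => x ^+ 4 - 2 * x ^+ 3 - 2 * x + 1) (pell_radius R).
Proof.
have [w2 /andP[w1 w3]] := sqrt3_bounds.
have [v2 /andP[v1 v3]] := sqrt_sqrt12_bounds.
have F x : x ^+ 4 - 2 * x ^+ 3 - 2 * x + 1 =
  (x - (1 + w - v) / 2) * (x - (1 + w + v) / 2) *
  ((x - (1 - w) / 2) ^+ 2 + w / 2).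
  have -> : (x - (1 + w - v) / 2) * (x - (1 + w + v) / 2) =
     x ^+ 2 - (1 + w) * x + ((1 + w) ^+ 2 - v ^+ 2) / 4 by field.
  have -> : (x - (1 - w) / 2) ^+ 2 + w / 2 =
    x ^+ 2 - (1 - w) * x + (1 + w ^+ 2) / 4 by field.
  rewrite v2 sqrrD w2 /= expr1n mul1r.
  (* The quartic is a difference of squares, as w^2 = 3. *)
  transitivity ((x ^+ 2 - x + 1) ^+ 2 - w ^+ 2 * x ^+ 2).
    by rewrite w2; ring.
  by field.
split.
- by rewrite /pell_radius -/w -/v; lra.
- by rewrite F /pell_radius -/w -/v subrr !mul0r.
move=> y y0; rewrite F => /eqP; rewrite !mulf_eq0 -orbA => /or3P[] /eqP h.
- by rewrite /pell_radius -/w -/v; lra.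
- by rewrite /pell_radius -/w -/v; lra.
- by have := sqr_ge0 (y - (1 - w) / 2); lra.
Qed.

Lemma annulus_of_close (z : R[i]) : ~ far_from_unit_circle (normc z) ->
  in_annulus (pell_radius R) (pell_radius R)^-1 z.
Proof.
move=> h; apply: in_annulusE; move: (normc z) h => r h.
have /andP[b1 b2] := pell_radius_bounds.
apply/andP; split.
  by case: (ltrP (pell_radius R) r) => // h1; case: h; left; lra.
have R0 : 0 < pell_radius R by lra.
have r25 : r < 25 / 11 by case: (ltrP r (25 / 11)) => // h1; case: h; right.
apply: (lt_trans r25).
by rewrite -[25 / 11]invrK ltf_pV2 ?posrE ?invr_gt0 //; lra.
Qed.

End PellRadius.

Theorem theorem4p1 (R : realType) :
  exists R1 : R,
    [/\ smallest_positive_root (fun x : R => x ^+ 4 - 2 * x ^+ 3 - 2 * x + 1) R1,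
        4 / 10 + 3 / 10 ^+ 2 + 5 / 10 ^+ 3 + 4 / 10 ^+ 4 + 2 / 10 ^+ 5 <= R1
          < 4 / 10 + 3 / 10 ^+ 2 + 5 / 10 ^+ 3 + 4 / 10 ^+ 4 + 3 / 10 ^+ 5,
        forall (n : nat) (p : {poly int}), (1 <= n)%N -> is_pell_poly n p ->
          forall z : R[i], complex_root p z -> in_annulus R1 R1^-1 z
      & forall (n : nat) (p : {poly int}), (2 <= n)%N -> is_pell_tilde_poly n p ->
          forall z : R[i], complex_root p z -> in_annulus R1 R1^-1 z].
Proof.
exists (pell_radius R); split.
- exact: pell_radius_smallest.
- exact: pell_radius_bounds.
- move=> [//|k] p _ [r h] z hz; apply: annulus_of_close.
  by apply: (pell_quotient_root_close h); right.
- move=> [//|[//|k]] p _ [s h] z hz; apply: annulus_of_close.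
  by apply: (pell_quotient_root_close h); left.
Qed.
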